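(* Let $A$ be an $n\times n$ real matrix. The FAS-QAP for matrix $A$ is linearizable if and only if $A$ is a balanced 3-cycle matrix.
   Context: All matrices have real entries, and $S_n$ denotes the set of permutations of $\{1,\ldots,n\}$. For $n\times n$ matrices $A=(a_{ij})$, $B=(b_{ij})$ and $\pi\in S_n$ put $\mathrm{QAP}(A,B,\pi)=\sum_{i=1}^n\sum_{j=1}^n a_{\pi(i)\pi(j)}\,b_{ij}$. For an $n\times n$ matrix $C=(c_{ij})$ and $\pi\in S_n$ put $\mathrm{LAP}(C,\pi)=\sum_{i=1}^n c_{i\pi(i)}$. The QAP with matrices $A$ and $B$ is called linearizable if there exists an $n\times n$ matrix $C$ such that $\mathrm{QAP}(A,B,\pi)=\mathrm{LAP}(C,\pi)$ for all $\pi\in S_n$. The feedback arc matrix $F_n=(f_{ij})$ is the $n\times n$ matrix with $f_{ij}=1$ if $1\le j<i\le n$ and $f_{ij}=0$ if $1\le i\le j\le n$. The FAS-QAP for an $n\times n$ matrix $A$ is the QAP with first matrix $A$ and second matrix $B=F_n$. An $n\times n$ matrix $A=(a_{ij})$ is a balanced 3-cycle matrix if $a_{ij}+a_{jk}+a_{ki}=a_{ji}+a_{kj}+a_{ik}$ for every three indices $i,j,k\in\{1,\ldots,n\}$ (the condition holds trivially when two of the indices coincide). *)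

(* Defs.v *)
From mathcomp Require Import all_boot all_order all_fingroup all_algebra.
From mathcomp Require Import reals.

Set Implicit Arguments.
Unset Strict Implicit.
Unset Printing Implicit Defensive.

Import Order.TTheory GRing.Theory Num.Theory.
Local Open Scope ring_scope.

Definition QAP (R : realType) (n : nat) (A B : 'M[R]_n) (pi : 'S_n) : R :=
  \sum_(i < n) \sum_(j < n) A (pi i) (pi j) * B i j.

Definition LAP (R : realType) (n : nat) (C : 'M[R]_n) (pi : 'S_n) : R :=
  \sum_(i < n) C i (pi i).

Definition linearizable (R : realType) (n : nat) (A B : 'M[R]_n) : Prop :=
  exists C : 'M[R]_n, forall pi : 'S_n, QAP A B pi = LAP C pi.

Definition feedback_arc_mx (R : realType) (n : nat) : 'M[R]_n :=
  \matrix_(i < n, j < n) (if (j < i)%N then 1 else 0).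

Definition FAS_QAP_linearizable (R : realType) (n : nat) (A : 'M[R]_n) : Prop :=
  linearizable A (feedback_arc_mx R n).

Definition balanced_3cycle (R : realType) (n : nat) (A : 'M[R]_n) : Prop :=
  forall i j k : 'I_n, A i j + A j k + A k i = A j i + A k j + A i k.

(* Main.v *)
Require Import Defs.
From mathcomp Require Import all_boot all_order all_fingroup all_algebra.
From mathcomp Require Import reals.
From mathcomp Require Import ring lra.

(** Both properties say that the skew part of [A] is a potential difference:
    there is [u] with [A x y - A y x = u x - u y] for all [x], [y]
    ([balanced_3cycleP]).  This is the usual cocycle criterion: summing a skew
    function around every triangle gives 0 exactly when it is a coboundary.

    If the problem is linearized by [C], exchange the items [x] and [y] placed
    at the first two positions of a permutation.  The objective changes only by
    the relative order of [x] and [y], that is by [A y x - A x y]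
    ([QAP_feedback_swap]), while the linear cost changes by an expression in the
    first two rows of [C] alone ([LAP_swap]).  Hence the difference of these two
    rows is a potential.

    Conversely, given a potential [u], the matrix [A x y - u x] is symmetric.
    The objective of a symmetric matrix does not depend on the permutation,
    since each unordered pair of items is counted once in either order
    ([QAP_feedback_sym]); the removed term [u x] is counted once for each
    predecessor of [x], so it costs [i * u x] when [x] is at position [i], which
    is linear ([QAP_feedback_row]). *)

Set Implicit Arguments.
Unset Strict Implicit.
Unset Printing Implicit Defensive.

Import Order.TTheory GRing.Theory Num.Theory.
Local Open Scope ring_scope.

(** Any fixed index [o] serves as base point of the potential: take
    [u x = A x o - A o x] and read the balance condition on [x], [y], [o]. *)
Lemma balanced_3cycleP (R : realType) (n : nat) (A : 'M[R]_n) :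
  balanced_3cycle A <->
  exists u : 'I_n -> R, forall x y, A x y - A y x = u x - u y.
Proof.
split=> [bal | [u Du] x y z]; last first.
  have := Du x y; have := Du y z; have := Du z x; lra.
case: n A bal => [|n] A bal; first by exists (fun=> 0) => -[].
exists (fun x => A x ord0 - A ord0 x) => x y.
have := bal x y ord0; lra.
Qed.

(** Every later item has both exchanged items among its predecessors, before and
    after the exchange, so only their mutual order matters. *)
Lemma QAP_feedback_swap (R : realType) (n : nat) (A : 'M[R]_n.+2)
    (pi : 'S_n.+2) (p := ord0 : 'I_n.+2) (q := lift ord0 ord0 : 'I_n.+2) :
  QAP A (feedback_arc_mx R n.+2) pi
    - QAP A (feedback_arc_mx R n.+2) (tperm p q * pi)%g
  = A (pi q) (pi p) - A (pi p) (pi q).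
Proof.
have Dpi j : (tperm p q * pi)%g (lift ord0 (lift ord0 j))
    = pi (lift ord0 (lift ord0 j)).
  by rewrite permM tpermD.
have Dp : (tperm p q * pi)%g p = pi q by rewrite permM tpermL.
have Dq : (tperm p q * pi)%g q = pi p by rewrite permM tpermR.
(* the contribution of each position splits into its first two predecessors,
   in which it is symmetric, and the others *)
have QE s : QAP A (feedback_arc_mx R n.+2) s = A (s q) (s p) +
    \sum_(i < n) (A (s (lift ord0 (lift ord0 i))) (s p)
      + A (s (lift ord0 (lift ord0 i))) (s q)
      + \sum_(j < n) A (s (lift ord0 (lift ord0 i))) (s (lift ord0 (lift ord0 j)))
          * (if (j < i)%N then 1 else 0)).
  rewrite /QAP big_ord_recl big1 => [|j _]; last by rewrite mxE ltn0 mulr0.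
  rewrite add0r big_ord_recl big_ord_recl big1 => [|j _]; last first.
    by rewrite mxE /= mulr0.
  rewrite mxE /= mulr1 addr0; congr (_ + _); apply: eq_bigr => i _.
  rewrite !big_ord_recl !mxE /= !mulr1 addrA; congr (_ + _).
  by apply: eq_bigr => j _; rewrite mxE.
rewrite !QE Dp Dq.
under [in X in _ - X]eq_bigr => i _.
  rewrite Dpi [X in X + _]addrC; under eq_bigr => j _ do rewrite Dpi.
  over.
ring.
Qed.

Lemma LAP_swap (R : realType) (n : nat) (C : 'M[R]_n) (pi : 'S_n)
    (p q : 'I_n) : p != q ->
  LAP C pi - LAP C (tperm p q * pi)%g
  = C p (pi p) + C q (pi q) - (C p (pi q) + C q (pi p)).
Proof.
move=> npq.
have LE s : LAP C s
    = C p (s p) + (C q (s q) + \sum_(i | (i != p) && (i != q)) C i (s i)).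
  by rewrite /LAP (bigD1 p) //= (bigD1 q) //= eq_sym.
rewrite !LE !permM tpermL tpermR.
rewrite [in X in _ - X](eq_bigr (fun i => C i (pi i))); first by ring.
by move=> i /andP[ip iq]; rewrite permM tpermD // eq_sym.
Qed.

(** A single pair of adjacent positions suffices, because any two items can be
    placed there; the potential is the row difference of [C] at this pair. *)
Lemma linearizable_potential (R : realType) (n : nat) (A : 'M[R]_n) :
  FAS_QAP_linearizable A ->
  exists u : 'I_n -> R, forall x y, A x y - A y x = u x - u y.
Proof.
case: n A => [|[|n]] A [C linC]; first by exists (fun=> 0) => -[].
  by exists (fun=> 0) => x y; rewrite [x]ord1 [y]ord1 !subrr.
pose p : 'I_n.+2 := ord0; pose q : 'I_n.+2 := lift ord0 ord0.
exists (fun x => C q x - C p x) => x y.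
have [->|nxy] := eqVneq x y; first by rewrite !subrr.
(* a permutation placing [y] at the first position and [x] at the second *)
pose s : 'S_n.+2 := (tperm p y * tperm (tperm p y q) x)%g.
have sq : s q = x by rewrite permM tpermL.
have sp : s p = y.
  rewrite permM tpermL; apply: tpermD => //.
  by rewrite -[X in _ != X](tpermL p y) (inj_eq perm_inj).
have := QAP_feedback_swap A s; cbv zeta; rewrite -/p -/q 2!linC.
rewrite (LAP_swap C s (isT : p != q)) sp sq; lra.
Qed.

(** Transposing the feedback arc matrix leaves the objective of a symmetric
    matrix unchanged, and adding the transpose yields the all-ones matrix with
    zero diagonal, for which the position of the items is irrelevant. *)
Lemma QAP_feedback_sym (R : realType) (n : nat) (B : 'M[R]_n) (pi : 'S_n) :
  (forall x y, B x y = B y x) ->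
  QAP B (feedback_arc_mx R n) pi
  = (\sum_x \sum_y B x y - \sum_x B x x) / 2.
Proof.
move=> symB; set F := feedback_arc_mx R n.
have QT : QAP B F pi = \sum_i \sum_j B (pi i) (pi j) * F j i.
  rewrite /QAP exchange_big; apply: eq_bigr => i _; apply: eq_bigr => j _.
  by rewrite symB.
have Q2 : QAP B F pi + QAP B F pi + \sum_x B x x = \sum_x \sum_y B x y.
  rewrite {2}QT /QAP -big_split.
  rewrite [X in _ + X](reindex_inj (@perm_inj _ pi)) -big_split.
  rewrite [RHS](reindex_inj (@perm_inj _ pi)); apply: eq_bigr => i _ /=.
  rewrite -big_split [RHS](reindex_inj (@perm_inj _ pi)).
  rewrite (bigD1 i) //= [RHS](bigD1 i) //= !mxE ltnn !mulr0 !add0r addrC.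
  congr (_ + _); apply: eq_bigr => j nji; rewrite !mxE.
  by case: ltngtP (nji) => [||/val_inj->]; rewrite ?eqxx // => _ _; ring.
lra.
Qed.

(** The item at position [i] pays its price [u] once per earlier position, and
    there are [i] of these because positions are numbered from 0. *)
Lemma QAP_feedback_row (R : realType) (n : nat) (u : 'I_n -> R) (pi : 'S_n) :
  QAP (\matrix_(x, y) u x) (feedback_arc_mx R n) pi
  = LAP (\matrix_(i, x) (i%:R * u x)) pi.
Proof.
apply: eq_bigr => i _; under eq_bigr => j _ do rewrite !mxE.
rewrite -mulr_sumr mxE mulrC; congr (_ * _).
by rewrite -big_mkcond (big_ord_narrow (ltnW (ltn_ord i))) sumr_const card_ord.
Qed.

Lemma potential_linearizable (R : realType) (n : nat) (A : 'M[R]_n)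
    (u : 'I_n -> R) :
  (forall x y, A x y - A y x = u x - u y) -> FAS_QAP_linearizable A.
Proof.
move=> Du; pose B : 'M[R]_n := A - \matrix_(x, y) u x.
have symB x y : B x y = B y x by rewrite !mxE; have := Du x y; lra.
pose K := (\sum_x \sum_y B x y - \sum_x B x x) / 2.
(* the constant [K] is spread evenly over the [n] positions *)
exists (\matrix_(i, x) (i%:R * u x) + const_mx (K / n%:R)) => pi.
have -> : QAP A (feedback_arc_mx R n) pi
    = LAP (\matrix_(i, x) (i%:R * u x)) pi + K.
  rewrite -QAP_feedback_row /K -(QAP_feedback_sym pi symB) /QAP -big_split.
  apply: eq_bigr => i _; rewrite -big_split; apply: eq_bigr => j _ /=.
  by rewrite !mxE; ring.
rewrite /LAP; under [RHS]eq_bigr => i _ do rewrite mxE [X in _ + X]mxE.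
rewrite big_split /= sumr_const card_ord; congr (_ + _).
rewrite -[RHS]mulr_natr.
(* when [n = 0] there is no position to carry [K], but then [K = 0] *)
have [n0|n_gt0] := posnP n; last by rewrite divfK // pnatr_eq0 -lt0n.
rewrite /K !big1 => [|x _|x _]; first by rewrite subrr !mul0r.
all: by have := leq_trans (ltn_ord x) (eq_leq n0).
Qed.

Theorem theorem4p4 (R : realType) (n : nat) (A : 'M[R]_n) :
  FAS_QAP_linearizable A <-> balanced_3cycle A.
Proof.
split=> [/linearizable_potential | /balanced_3cycleP[u]].
  by move/balanced_3cycleP.
exact: potential_linearizable.
Qed.
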